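(* Let $q$ be a left-invariant pseudo-Riemannian metric on $\mathrm{SL}(2,\mathbb{R})$ with associated isomorphism $\Phi$, and suppose that $\Phi$ has a (unique, real) eigenvalue with algebraic multiplicity $3$ and geometric multiplicity $1$. Then there exists a plane (two-dimensional linear subspace of $\mathfrak{sl}(2,\mathbb{R})$), invariant under the geodesic flow, over which all geodesics are complete. Furthermore, all the other geodesics are $\mathbb{R}^+$-complete or $\mathbb{R}^-$-complete, although not complete.
   Context: Let $B(x,y)=2\,\mathrm{Tr}(xy)$ on $\mathfrak{sl}(2,\mathbb{R})$ (one half of the Killing form). The associated isomorphism of a left-invariant pseudo-Riemannian metric $q$ is the unique $B$-self-adjoint linear isomorphism $\Phi$ of $\mathfrak{sl}(2,\mathbb{R})$ with $q(x,y)=B(\Phi x,y)$ for all $x,y\in\mathfrak{sl}(2,\mathbb{R})$. A curve $\gamma$ in $\mathrm{SL}(2,\mathbb{R})$ is a geodesic of $q$ if and only if $z(t)=\Phi(\gamma(t)^{-1}\dot\gamma(t))$ solves the quadratic (Lax/Euler–Arnold) equation $\dot z=[z,\Phi^{-1}z]$ on $\mathfrak{sl}(2,\mathbb{R})$, and maximal geodesics and the corresponding maximal solutions have the same interval of definition. Geodesics are identified with the solutions of this equation; invariance of a plane means invariance under this equation, and a geodesic is ''over'' the plane if the corresponding solution $z(t)$ lies in it. A geodesic is complete if its maximal interval of definition is $\mathbb{R}$; it is $\mathbb{R}^+$-complete (resp. $\mathbb{R}^-$-complete) if its maximal interval of definition is unbounded above (resp. below). *)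

(* Defs.v *)
From HB Require Import structures.
From mathcomp Require Import all_boot all_order all_algebra.
From mathcomp Require Import all_classical all_reals all_analysis.
Set Implicit Arguments.
Unset Strict Implicit.
Unset Printing Implicit Defensive.
Import Order.TTheory GRing.Theory Num.Theory.
Import numFieldNormedType.Exports.
Local Open Scope classical_set_scope.
Local Open Scope ring_scope.

Definition sl2_space (R : realType) : {vspace 'M[R]_2} :=
  lker (linfun (mxtrace : 'M[R]_2 -> R^o)).

Notation sl2 R := (subvs_of (sl2_space R)).

Lemma mem_sl2_space (R : realType) (x : 'M[R]_2) :
  (x \in sl2_space R) = (\tr x == 0).
Proof. by rewrite memv_ker lfunE. Qed.

Lemma mxcomm_sl2 (R : realType) (x y : 'M[R]_2) :
  x *m y - y *m x \in sl2_space R.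
Proof. by rewrite mem_sl2_space raddfB /= mxtrace_mulC subrr. Qed.

Definition sl2_bracket (R : realType) (x y : sl2 R) : sl2 R :=
  Subvs (mxcomm_sl2 (vsval x) (vsval y)).

Definition sl2_form (R : realType) (x y : sl2 R) : R :=
  2 * \tr (vsval x *m vsval y).

(* A left-invariant pseudo-Riemannian metric on SL(2,R) is given by its value
   at the identity, a nondegenerate symmetric bilinear form [q] on sl(2,R). *)
Definition associated_isomorphism (R : realType)
    (q : {symmetric (sl2 R)}) (Phi : 'End(sl2 R)) : Prop :=
  [/\ forall x y, sl2_form (Phi x) y = sl2_form x (Phi y),
      bijective Phi &
      forall x y, q x y = sl2_form (Phi x) y].

Definition algebraic_multiplicity (K : fieldType) (V : vectType K)
    (f : 'End(V)) (a : K) : nat :=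
  mup a (char_poly (passmx.mxof (vbasis {:V}) (vbasis {:V}) f)).

Definition geometric_multiplicity (K : fieldType) (V : vectType K)
    (f : 'End(V)) (a : K) : nat :=
  \dim (passmx.leigenspace f a).

(* A solution is a pair of an interval [I] and a curve [z]; the values of [z]
   outside [I] are irrelevant.  [(Phi^-1)%VF] is the inverse of [Phi] as soon
   as [Phi] is bijective. *)
Definition euler_arnold_solution (R : realType) (Phi : 'End(sl2 R))
    (I : set R) (z : R -> sl2 R) : Prop :=
  [/\ open I, is_interval I, I !=set0 &
      forall t, I t ->
        is_derive t (1 : R) (fun s => vsval (z s))
          (vsval (sl2_bracket (z t) ((Phi^-1)%VF (z t))))].

(* Geodesics are identified with the maximal solutions; [I] is then the
   maximal interval of definition. *)
Definition geodesic (R : realType) (Phi : 'End(sl2 R))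
    (I : set R) (z : R -> sl2 R) : Prop :=
  euler_arnold_solution Phi I z /\
  forall (J : set R) (w : R -> sl2 R),
    euler_arnold_solution Phi J w ->
    I `<=` J -> (forall t, I t -> w t = z t) -> J = I.

Definition flow_invariant (R : realType) (Phi : 'End(sl2 R))
    (P : {vspace (sl2 R)}) : Prop :=
  forall (I : set R) (z : R -> sl2 R), euler_arnold_solution Phi I z ->
  forall t0, I t0 -> z t0 \in P -> forall t, I t -> z t \in P.

Definition lies_over (R : realType) (P : {vspace (sl2 R)})
    (I : set R) (z : R -> sl2 R) : Prop :=
  forall t, I t -> z t \in P.

Definition complete_interval (R : realType) (I : set R) : Prop :=
  I = [set: R].

Definition Rplus_complete_interval (R : realType) (I : set R) : Prop :=
  ~ has_ubound I.

Definition Rminus_complete_interval (R : realType) (I : set R) : Prop :=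
  ~ has_lbound I.

(* Main.v *)
Require Import Defs.
From HB Require Import structures.
From mathcomp Require Import all_boot all_order all_algebra.
From mathcomp Require Import all_classical all_reals all_analysis.
From mathcomp Require Import ring lra.
Import Order.TTheory GRing.Theory Num.Theory.
Import numFieldNormedType.Exports.
Local Open Scope classical_set_scope.
Local Open Scope ring_scope.

(** Write Phi = lambda + N with N^2 <> 0 = N^3.  By self-adjointness there is a
    basis e1 = N^2 e3, e2 = N e3, e3 of sl(2,R) with B(e1,e3) = B(e2,e2) <> 0 and
    all other products zero, and the invariance of B forces [e1,e2] = k e1,
    [e2,e3] = k e3, [e3,e1] = k e2 with k <> 0.  For z = a e1 + b e2 + c e3 the
    Euler-Arnold equation becomes triangular:
      c' = - mu c^2,  b' = mu b c + nu c^2,  a' = mu (a c - b^2) - nu b c.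
    On the invariant plane c = 0 it has affine solutions.  Off the plane, c = 1/s
    with s an affine function of t, a and b are Laurent polynomials in s, and the
    maximal interval is a half-line bounded by the zero of s. *)

(** * Entrywise derivatives and uniqueness for scalar linear equations *)

Lemma is_derive_mxP (R : realFieldType) (m n : nat) (F : R -> 'M[R]_(m, n))
    (dF : 'M[R]_(m, n)) (t : R) :
  is_derive t (1 : R) F dF <->
  forall i j, is_derive t (1 : R) (fun s => F s i j) (dF i j).
Proof.
split=> [[Fd Fv] i j|Fij].
  have /derivable_mxP Fijd := Fd; apply: DeriveDef; first exact: Fijd.
  by rewrite -Fv derive_mx// mxE.
have Fd : derivable F t 1 by apply/derivable_mxP => i j; have [] := Fij i j.
apply: DeriveDef => //; rewrite derive_mx//; apply/matrixP => i j; rewrite mxE.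
by have [] := Fij i j.
Qed.

Lemma is_derive_continuous (R : realFieldType) (f : R -> R) (t df : R) :
  is_derive t (1 : R) f df -> {for t, continuous f}.
Proof. by move=> [fd _]; exact/differentiable_continuous/derivable1_diffP. Qed.

(* With [M] a bound of [g], the function [f ^ 2 * exp (- 2 M t)] is
   nonincreasing. *)
Lemma linear_ode_eq0_right (R : realType) (f g : R -> R) (t0 t1 : R) :
  t0 <= t1 ->
  (forall t, t0 <= t <= t1 -> {for t, continuous g}) ->
  (forall t, t0 <= t <= t1 -> is_derive t (1 : R) f (g t * f t)) ->
  f t0 = 0 -> f t1 = 0.
Proof.
move=> t01 cg df f0.
have [|M _ gM] := EVT_max t01 (f := g).
  by apply: continuous_in_subspaceT => t; rewrite inE/= in_itv/= => /cg.
pose h t := f t * f t * expR (- (2 * g M) * t).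
have dh t : t0 <= t <= t1 ->
    is_derive t (1 : R) h (2 * (f t * f t) * (g t - g M) * expR (- (2 * g M) * t)).
  move=> tI; have dft := df t tI.
  apply: is_derive_eq; rewrite /GRing.scale/= ?expr1; ring.
have h10 : h t1 <= h t0.
  have oo t : t \in `]t0, t1[ -> t0 <= t <= t1.
    by rewrite in_itv/= => /andP[/ltW -> /ltW ->].
  apply: (@ler0_derive1_le_cc R h t0 t1) => //.
  - by move=> t /oo/dh[].
  - move=> t /oo tI; rewrite derive1E; have [_ ->] := dh t tI.
    have := gM t; rewrite in_itv/= => /(_ tI); rewrite -subr_le0 => gle.
    by rewrite mulr_le0_ge0 ?expR_ge0// mulr_ge0_le0// mulr_ge0// -expr2 sqr_ge0.
  - apply: continuous_in_subspaceT => t; rewrite inE/= in_itv/= => /dh.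
    exact: is_derive_continuous.
  - by rewrite in_itv/= lexx t01.
  - by rewrite in_itv/= lexx t01.
move: h10; rewrite /h f0 mul0r mul0r pmulr_lle0 ?expR_gt0// -expr2 => f1.
by apply/eqP; rewrite -sqrf_eq0 eq_le f1 sqr_ge0.
Qed.

(** Times before [t0] reduce to later ones by the reflection t -> -t, which replaces the coefficient
    g(t) by -g(-t). *)
Lemma linear_ode_eq0 (R : realType) (I : set R) (f g : R -> R) (t0 : R) :
  is_interval I ->
  (forall t, I t -> {for t, continuous g}) ->
  (forall t, I t -> is_derive t (1 : R) f (g t * f t)) ->
  I t0 -> f t0 = 0 -> forall t, I t -> f t = 0.
Proof.
move=> itvI cg df It0 f0 t1 It1.
have [t01|/ltW t10] := leP t0 t1.
  have sub t : t0 <= t <= t1 -> I t by exact: itvI.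
  by apply: (linear_ode_eq0_right _ f g t0 t1) => // t /sub; [exact: cg|exact: df].
have sub t : - t0 <= t <= - t1 -> I (- t).
  by move=> /andP[? ?]; apply: (itvI t1 t0) => //; rewrite lerNr lerNl; apply/andP.
rewrite -[t1]opprK.
apply: (linear_ode_eq0_right _ (fun t => f (- t)) (fun t => - g (- t)) (- t0)).
- by rewrite lerN2.
- move=> t /sub It; apply: continuousN.
  by apply: continuous_comp; [exact: opp_continuous|exact: cg].
- move=> t /sub It; have dft := df _ It.
  by apply: is_derive_eq; rewrite mulrN mulr1 mulNr.
- by rewrite opprK.
Qed.

(** * Multiplicities of an eigenvalue in dimension three *)

(** A root of multiplicity equal to the degree forces the characteristic polynomial to be (X - a)^3,
    and Cayley-Hamilton applies. The size stays a variable because it will be [\dim {:V}], equal to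
    3 only by a proof. *)
Lemma mup_char_poly_nilpotent (K : fieldType) (n : nat) (A : 'M[K]_n) (a : K) :
  mup a (char_poly A) = n -> n = 3%N ->
  (A - a%:M) *m (A - a%:M) *m (A - a%:M) = 0.
Proof.
move=> mupA n3; subst n.
have pA : char_poly A = ('X - a%:P) ^+ 3.
  apply/esym/eqP; rewrite -eqp_monic ?monic_exp ?monicXsubC ?char_poly_monic//.
  have dv : ('X - a%:P) ^+ 3 %| char_poly A.
    by rewrite -mup_geq ?mupA// monic_neq0// char_poly_monic.
  by rewrite -(dvdp_size_eqp dv) size_exp_XsubC size_char_poly.
have := Cayley_Hamilton A; rewrite pA rmorphXn rmorphB/= horner_mx_X horner_mx_C.
by rewrite !exprS expr0 mulr1 mulrA.
Qed.

Lemma algebraic_multiplicity_dim3 (K : fieldType) (V : vectType K)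
    (f : 'End(V)) (a : K) (x : V) :
  \dim {:V} = 3%N -> algebraic_multiplicity f a = 3%N ->
  let N := (f - a *: \1)%VF in N (N (N x)) = 0.
Proof.
move=> dV mupf N; set e := vbasis {:V}; have eb : basis_of {:V} e := vbasisP _.
have mN : passmx.mxof e e N = passmx.mxof e e f - a%:M.
  rewrite /N addrC -scaleNr passmx.mxof_linear passmx.mxof1 ?(basis_free eb)//.
  by rewrite scaleNr scalemx1 addrC.
have /mup_char_poly_nilpotent : mup a (char_poly (passmx.mxof e e f)) = \dim {:V}.
  exact: etrans mupf (esym dV).
move=> /(_ dV); rewrite -mN => N3.
rewrite -(passmx.rVofK eb x) !(passmx.hom_vecof e eb) -!mulmxA [X in _ *m X]mulmxA.
by apply/eqP; rewrite N3 mulmx0 passmx.vecof_eq0.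
Qed.

(** If N^2 were 0, the image of N, of dimension 2 by rank-nullity, would lie in its kernel, of
    dimension 1. *)
Lemma geometric_multiplicity1_dim3 (K : fieldType) (V : vectType K)
    (f : 'End(V)) (a : K) :
  \dim {:V} = 3%N -> geometric_multiplicity f a = 1%N ->
  let N := (f - a *: \1)%VF in exists x, N (N x) != 0.
Proof.
move=> dV gf N; apply: contrapT => /forallNP N0.
have le : (limg N <= lker N)%VS.
  apply/subvP => _ /memv_imgP[x _ ->]; rewrite memv_ker.
  exact/negPn/negP/N0.
have := limg_ker_dim N fullv; rewrite capfv dV [\dim (lker N)]gf.
move=> /eqP; rewrite add1n eqSS => /eqP d2.
by have := dimvS le; rewrite d2 [\dim (lker N)]gf.
Qed.

(** * The form and the bracket of sl(2,R) in matrix entries *)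

Section sl2.
Variable R : realType.
Implicit Types x y z w : sl2 R.

Lemma sl2_mx11 x : vsval x 1 1 = - vsval x 0 0.
Proof.
have := subvsP x; rewrite mem_sl2_space /mxtrace big_ord_recl big_ord1.
by rewrite (_ : lift _ _ = 1) 1?addrC ?addr_eq0 => [/eqP|]//; apply/val_inj.
Qed.

Lemma sl2_formE x y : sl2_form x y =
  2 * (2 * (vsval x 0 0 * vsval y 0 0) + vsval x 0 1 * vsval y 1 0
       + vsval x 1 0 * vsval y 0 1).
Proof.
rewrite /sl2_form /mxtrace big_ord_recl big_ord1 !mxE !big_ord_recl !big_ord0 !addr0.
rewrite (_ : lift _ _ = 1); last exact/val_inj.
by rewrite !sl2_mx11; ring.
Qed.

Lemma sl2_eqP x y : vsval x 0 0 = vsval y 0 0 -> vsval x 0 1 = vsval y 0 1 ->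
  vsval x 1 0 = vsval y 1 0 -> x = y.
Proof.
move=> e00 e01 e10; apply/val_inj/matrixP => i j /=.
have c2 (k : 'I_2) : k = 0 \/ k = 1.
  by case: k => -[|[|]]// p; [left|right]; apply/val_inj.
by have [->|->] := c2 i; have [->|->] := c2 j; rewrite ?sl2_mx11 ?e00.
Qed.

Lemma sl2_bracketE x y : let b := vsval (sl2_bracket x y) in
  [/\ b 0 0 = vsval x 0 1 * vsval y 1 0 - vsval x 1 0 * vsval y 0 1,
      b 0 1 = 2 * (vsval x 0 0 * vsval y 0 1 - vsval x 0 1 * vsval y 0 0) &
      b 1 0 = 2 * (vsval x 1 0 * vsval y 0 0 - vsval x 0 0 * vsval y 1 0)].
Proof.
rewrite /sl2_bracket/= !mxE !big_ord_recl !big_ord0 !addr0.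
rewrite (_ : lift _ _ = 1); last exact/val_inj.
by rewrite !sl2_mx11; split; ring.
Qed.

Lemma sl2_mk (a b c : R) : exists x,
  [/\ vsval x 0 0 = a, vsval x 0 1 = b & vsval x 1 0 = c].
Proof.
pose M : 'M[R]_2 := \matrix_(i, j)
  if i == 0 then (if j == 0 then a else b) else (if j == 0 then c else - a).
have M0 : M \in sl2_space R.
  by rewrite mem_sl2_space /mxtrace big_ord_recl big_ord1 !mxE/= subrr.
by exists (Subvs M0); rewrite /= !mxE.
Qed.


Lemma sl2_formC x y : sl2_form x y = sl2_form y x.
Proof. by rewrite /sl2_form mxtrace_mulC. Qed.

Lemma sl2_formDl x y z : sl2_form (x + y) z = sl2_form x z + sl2_form y z.
Proof. by rewrite /sl2_form linearD mulmxDl linearD/= mulrDr. Qed.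

Lemma sl2_formZl (a : R) x z : sl2_form (a *: x) z = a * sl2_form x z.
Proof. by rewrite /sl2_form linearZ/= -scalemxAl linearZ/= mulrCA. Qed.

Lemma sl2_formDr x y z : sl2_form z (x + y) = sl2_form z x + sl2_form z y.
Proof. by rewrite sl2_formC sl2_formDl !(sl2_formC z). Qed.

Lemma sl2_formZr (a : R) x z : sl2_form z (a *: x) = a * sl2_form z x.
Proof. by rewrite sl2_formC sl2_formZl (sl2_formC z). Qed.

Lemma sl2_form0l x : sl2_form 0 x = 0.
Proof. by rewrite -(scale0r 0) sl2_formZl mul0r. Qed.

(** Pairing x with its transpose gives a positive combination of the squares of the entries. *)
Lemma sl2_form_nondegenerate x : (forall y, sl2_form x y = 0) -> x = 0.
Proof.
move=> x0; have [y [y00 y01 y10]] :=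
  sl2_mk (vsval x 0 0) (vsval x 1 0) (vsval x 0 1).
have := x0 y; rewrite sl2_formE y00 y01 y10 => s0.
have := sqr_ge0 (vsval x 0 0); have := sqr_ge0 (vsval x 0 1).
have := sqr_ge0 (vsval x 1 0); rewrite !expr2 => p q r.
have e0 (u : R) : u * u = 0 -> u = 0.
  by move=> /eqP; rewrite mulf_eq0 orbb => /eqP.
by apply: sl2_eqP; rewrite linear0 mxE; apply: e0; lra.
Qed.

Lemma sl2_bracketC x y : sl2_bracket y x = - sl2_bracket x y.
Proof. by apply/val_inj; rewrite [RHS](linearN vsval) /= opprB. Qed.

Lemma sl2_bracketDl x y z :
  sl2_bracket (x + y) z = sl2_bracket x z + sl2_bracket y z.
Proof.
apply/val_inj; rewrite [RHS](linearD vsval) /=.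
by rewrite mulmxDl mulmxDr opprD; exact: addrACA.
Qed.

Lemma sl2_bracketZl (a : R) x z : sl2_bracket (a *: x) z = a *: sl2_bracket x z.
Proof.
apply/val_inj; rewrite [RHS]linearZ /=.
by rewrite -scalemxAl -scalemxAr -scalerBr.
Qed.

Lemma sl2_bracketDr x y z :
  sl2_bracket z (x + y) = sl2_bracket z x + sl2_bracket z y.
Proof. by rewrite sl2_bracketC sl2_bracketDl opprD -!sl2_bracketC. Qed.

Lemma sl2_bracketZr (a : R) x z : sl2_bracket z (a *: x) = a *: sl2_bracket z x.
Proof. by rewrite sl2_bracketC sl2_bracketZl -scalerN -sl2_bracketC. Qed.

Lemma sl2_bracketxx x : sl2_bracket x x = 0.
Proof. by apply/val_inj; rewrite /= subrr. Qed.

(** Invariance of the form, written as cyclic symmetry of the trilinear form B([x,y],z). *)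
Lemma sl2_form_bracket x y z :
  sl2_form (sl2_bracket x y) z = sl2_form (sl2_bracket y z) x.
Proof.
rewrite !sl2_formE.
have [-> -> ->] := sl2_bracketE x y; have [-> -> ->] := sl2_bracketE y z.
ring.
Qed.

Lemma sl2_bracket_neq0 : exists x y, sl2_bracket x y != 0.
Proof.
have [x [x00 x01 x10]] := sl2_mk 0 1 0; have [y [y00 y01 y10]] := sl2_mk 0 0 1.
exists x, y; apply/eqP => /(congr1 (fun u : sl2 R => vsval u 0 0)).
have [-> _ _] := sl2_bracketE x y.
by rewrite x01 y10 x10 y01 linear0 mxE mulr1 mulr0 subr0; apply/eqP/oner_neq0.
Qed.

(** Rank-nullity for the trace, a nonzero linear form on a space of dimension 4. *)
Lemma dim_sl2 : \dim {:sl2 R} = 3%N.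
Proof.
rewrite dimvf; change (\dim (sl2_space R) = 3%N).
have := limg_ker_dim (linfun (mxtrace : 'M[R]_2 -> R^o)) fullv.
rewrite capfv -/(sl2_space R) dimvf dim_matrix.
suff -> : \dim (limg (linfun (mxtrace : 'M[R]_2 -> R^o))) = 1%N.
  by rewrite addn1 => -[].
apply/eqP; rewrite eqn_leq; apply/andP; split.
  by rewrite (leq_trans (dimvS (subvf _)))// dimvf.
rewrite lt0n dimv_eq0; apply/eqP => im0.
have := memv_img (linfun (mxtrace : 'M[R]_2 -> R^o)) (memvf (1%:M)).
by rewrite im0 lfunE/= mxtrace1 memv0 pnatr_eq0.
Qed.

End sl2.

(** * Bases with antidiagonal Gram matrix *)

Section null_basis.
Variables (R : realType) (e1 e2 e3 : sl2 R) (eps : R).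
Hypothesis eps_neq0 : eps != 0.
Hypotheses (B11 : sl2_form e1 e1 = 0) (B12 : sl2_form e1 e2 = 0)
  (B13 : sl2_form e1 e3 = eps) (B22 : sl2_form e2 e2 = eps)
  (B23 : sl2_form e2 e3 = 0) (B33 : sl2_form e3 e3 = 0).

Let B21 : sl2_form e2 e1 = 0. Proof. by rewrite sl2_formC. Qed.
Let B31 : sl2_form e3 e1 = eps. Proof. by rewrite sl2_formC. Qed.
Let B32 : sl2_form e3 e2 = 0. Proof. by rewrite sl2_formC. Qed.
Let gram := (B11, B12, B13, B21, B22, B23, B31, B32, B33).
Let formE := (sl2_formDl, sl2_formZl).

(** Since the Gram matrix is antidiagonal, pairing with [e1], [e2], [e3] reads off the coordinates
    in reverse order, up to the factor [eps]. *)
Lemma null_basis_form (a b c : R) : let z := a *: e1 + b *: e2 + c *: e3 in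
  [/\ sl2_form z e1 = c * eps, sl2_form z e2 = b * eps & sl2_form z e3 = a * eps].
Proof.
by rewrite /= !formE !gram !mulr0 ?addr0 ?add0r.
Qed.

Lemma null_basis_inj (a b c a' b' c' : R) :
  a *: e1 + b *: e2 + c *: e3 = a' *: e1 + b' *: e2 + c' *: e3 ->
  [/\ a = a', b = b' & c = c'].
Proof.
move=> zz; have [+ + +] := null_basis_form a b c.
rewrite zz; have [-> -> ->] := null_basis_form a' b' c'.
by move=> /(mulIf eps_neq0)-> /(mulIf eps_neq0)-> /(mulIf eps_neq0)->.
Qed.

Lemma null_basis_free : free [:: e1; e2; e3].
Proof.
rewrite -[X in free X]/(tval [tuple e1; e2; e3]); apply/freeP => k.
rewrite !big_ord_recl big_ord0 addr0/= addrA => k0.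
have [] := @null_basis_inj _ _ _ 0 0 0 (etrans k0 _).
  by rewrite !scale0r !addr0.
move=> k1 k2 k3 i.
by case: i => -[|[|[|]]]// p; [rewrite -[RHS]k1|rewrite -[RHS]k2|rewrite -[RHS]k3];
  congr k; apply/val_inj.
Qed.

Lemma null_basis_expansion z : z = (sl2_form z e3 / eps) *: e1 +
  (sl2_form z e2 / eps) *: e2 + (sl2_form z e1 / eps) *: e3.
Proof.
have bas : basis_of fullv [:: e1; e2; e3].
  by rewrite basisEfree null_basis_free subvf dim_sl2.
have := coord_basis (X := [tuple e1; e2; e3]) bas (memvf z).
rewrite !big_ord_recl big_ord0 addr0/= addrA.
move: (coord _ _ z) (coord _ _ z) (coord _ _ z) => c b a ->.
by have [-> -> ->] := null_basis_form a b c; rewrite !mulfK.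
Qed.

(** By invariance [x,y] is orthogonal to x and y, so the bracket of two basis vectors has a single
    nonzero coordinate at most; cyclic symmetry makes the three coordinates equal. *)
Lemma null_basis_bracket : exists2 k, k != 0 &
  [/\ sl2_bracket e1 e2 = k *: e1, sl2_bracket e2 e3 = k *: e3 &
      sl2_bracket e3 e1 = k *: e2].
Proof.
have xxy x y : sl2_form (sl2_bracket x y) x = 0.
  by rewrite sl2_form_bracket sl2_form_bracket sl2_bracketxx sl2_form0l.
have xyy x y : sl2_form (sl2_bracket x y) y = 0.
  by rewrite sl2_form_bracket sl2_bracketxx sl2_form0l.
pose k := sl2_form (sl2_bracket e1 e2) e3 / eps.
have b12 : sl2_bracket e1 e2 = k *: e1.
  rewrite [LHS]null_basis_expansion xxy xyy.
  by rewrite !mul0r !scale0r !addr0.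
have b23 : sl2_bracket e2 e3 = k *: e3.
  rewrite [LHS]null_basis_expansion xxy xyy -sl2_form_bracket.
  by rewrite !mul0r !scale0r !add0r.
have b31 : sl2_bracket e3 e1 = k *: e2.
  rewrite [LHS]null_basis_expansion xxy xyy sl2_form_bracket.
  by rewrite !mul0r !scale0r !add0r addr0.
(* With k = 0 the bracket would vanish on the basis, hence identically by bilinearity. *)
exists k => //; apply/eqP => k0; have [x [y /eqP]] := sl2_bracket_neq0 R; apply.
rewrite (null_basis_expansion x) (null_basis_expansion y).
rewrite !(sl2_bracketDl, sl2_bracketZl, sl2_bracketDr, sl2_bracketZr).
rewrite !sl2_bracketxx (sl2_bracketC R e1 e2) (sl2_bracketC R e2 e3).
by rewrite (sl2_bracketC R e3 e1) b12 b23 b31 k0 !(scale0r, oppr0, scaler0, addr0).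
Qed.

End null_basis.

(** Starting from u with B(N^2 u, u) nonzero, u is corrected by multiples of N u and N^2 u into
    [e3]. The products involving [e1], and B(e2,e2), follow from self-adjointness and N^3 = 0. *)
Lemma nilpotent_null_basis (R : realType) (N : 'End(sl2 R)) (v : sl2 R) :
  (forall x y, sl2_form (N x) y = sl2_form x (N y)) ->
  (forall x, N (N (N x)) = 0) -> N (N v) != 0 ->
  exists (e1 e2 e3 : sl2 R) (eps : R), [/\ eps != 0,
    [/\ N e1 = 0, N e2 = e1 & N e3 = e2],
    [/\ sl2_form e1 e1 = 0, sl2_form e1 e2 = 0 & sl2_form e1 e3 = eps] &
    [/\ sl2_form e2 e2 = eps, sl2_form e2 e3 = 0 & sl2_form e3 e3 = 0]].
Proof.
move=> adjN N3 N2v.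
have [u] : exists u, sl2_form (N (N u)) u != 0.
  (* By polarisation, [N \o N] would otherwise vanish. *)
  apply: contrapT => /forallNP Q0.
  have {}Q0 u : sl2_form (N (N u)) u = 0 by apply/eqP/negPn/negP/Q0.
  move/eqP: N2v; apply; apply: sl2_form_nondegenerate => w.
  have := Q0 (v + w); rewrite !linearD/= !(sl2_formDl, sl2_formDr) !Q0.
  rewrite adjN adjN sl2_formC add0r addr0 => /eqP.
  by rewrite -mulr2n mulrn_eq0/= => /eqP; rewrite sl2_formC.
set eps := sl2_form _ _ => eps0.
(* [al] solves B(e3, N e3) = B(N u, u) + 2 al eps = 0; then [be] solves B(e3, e3) = 0, which is
   linear in [be] with coefficient 2 eps. *)
pose al := - sl2_form (N u) u / (2 * eps).
pose be := - (sl2_form u u + 2 * al * sl2_form (N u) u + al ^+ 2 * eps) / (2 * eps).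
pose e3 := u + al *: N u + be *: N (N u).
have Ne3 : N e3 = N u + al *: N (N u).
  by rewrite /e3 !linearD !linearZ/= N3 scaler0 addr0.
have NNe3 : N (N e3) = N (N u) by rewrite Ne3 linearD linearZ/= N3 scaler0 addr0.
exists (N (N u)), (N e3), e3, eps => //.
have c12 : sl2_form (N (N u)) (N u) = 0 by rewrite -adjN N3 sl2_form0l.
have c11 : sl2_form (N (N u)) (N (N u)) = 0 by rewrite -adjN N3 sl2_form0l.
have c22 : sl2_form (N u) (N u) = eps by rewrite -adjN.
have c21 : sl2_form (N u) (N (N u)) = 0 by rewrite sl2_formC.
have c31 : sl2_form u (N (N u)) = eps by rewrite sl2_formC.
have c32 : sl2_form u (N u) = sl2_form (N u) u by rewrite sl2_formC.
split => //.
- rewrite Ne3 /e3; split=> //;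
  by rewrite !(sl2_formDr, sl2_formZr) ?c11 ?c12 -?/eps !mulr0 !addr0.
- rewrite Ne3 /e3; split=> //;
  rewrite !(sl2_formDl, sl2_formZl) !(sl2_formDr, sl2_formZr) ?c11 ?c12 ?c21 ?c22
    ?c31 ?c32 -?/eps /be /al; field => //.
Qed.

(** * The triangular system and its explicit solutions *)

Section triangular_system.
Variables (R : realType) (mu nu : R).

(** The set [I] is arbitrary, so that the rational solutions can be stated on the complement of
    their pole. *)
Definition triangular_solution (I : set R) (a b c : R -> R) : Prop :=
  forall t, I t -> [/\
    is_derive t (1 : R) a (mu * (a t * c t - b t ^+ 2) - nu * (b t * c t)),
    is_derive t (1 : R) b (mu * (b t * c t) + nu * c t ^+ 2) &
    is_derive t (1 : R) c (- mu * c t ^+ 2)].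

(** The differences of two solutions, taken in the order c, b, a, satisfy homogeneous linear
    equations: the coefficient is -mu (c + c') for c, and mu c for b and a once the earlier
    coordinates agree. *)
Lemma triangular_solution_unique (I : set R) (a b c a' b' c' : R -> R) (t0 : R) :
  is_interval I ->
  triangular_solution I a b c -> triangular_solution I a' b' c' ->
  I t0 -> a t0 = a' t0 -> b t0 = b' t0 -> c t0 = c' t0 ->
  forall t, I t -> [/\ a t = a' t, b t = b' t & c t = c' t].
Proof.
move=> itvI S S' It0 a0 b0 c0.
have cc' t : I t -> c t = c' t.
  move=> It; apply/eqP; rewrite -subr_eq0; apply/eqP; move: t It.
  apply: (linear_ode_eq0 _ _ (fun t => c t - c' t)
    (fun t => - mu * (c t + c' t)) t0) => // [t It|t It|]; last by rewrite c0 subrr.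
    have [_ _ dc] := S t It; have [_ _ dc'] := S' t It.
    by apply: is_derive_continuous; apply: is_derive_eq; reflexivity.
  have [_ _ dc] := S t It; have [_ _ dc'] := S' t It.
  by apply: is_derive_eq; ring.
have cg t : I t -> {for t, continuous (fun t => mu * c t)}.
  move=> It; have [_ _ dc] := S t It.
  by apply: is_derive_continuous; apply: is_derive_eq; reflexivity.
have bb' t : I t -> b t = b' t.
  move=> It; apply/eqP; rewrite -subr_eq0; apply/eqP; move: t It.
  apply: (linear_ode_eq0 _ _ (fun t => b t - b' t) (fun t => mu * c t) t0)
    => // [t It|]; last by rewrite b0 subrr.
  have [_ db _] := S t It; have [_ db' _] := S' t It.
  by apply: is_derive_eq; rewrite -!(cc' _ It); ring.
move=> t It; rewrite cc'// bb'//; split => //.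
apply/eqP; rewrite -subr_eq0; apply/eqP; move: t It.
apply: (linear_ode_eq0 _ _ (fun t => a t - a' t) (fun t => mu * c t) t0)
  => // [t It|]; last by rewrite a0 subrr.
have [da _ _] := S t It; have [da' _ _] := S' t It.
by apply: is_derive_eq; rewrite -!(cc' _ It) -!(bb' _ It); ring.
Qed.

Lemma triangular_solution_c0 (I : set R) (a0 b0 t0 : R) :
  triangular_solution I (fun t => a0 - mu * b0 ^+ 2 * (t - t0)) (cst b0) (cst 0).
Proof.
move=> t It; split.
- by apply: is_derive_eq; rewrite /cst /GRing.scale/=; ring.
- by apply: is_derive_eq; rewrite /cst/=; ring.
- by apply: is_derive_eq; rewrite /cst/=; ring.
Qed.

(* In the time [s = mu (t - ts)] the equation of [c] integrates to [c = 1 / s];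
   those of [b / s] and [a / s] are then quadratures whose primitives are
   rational in [s]. *)
Lemma triangular_solution_rational (A B ts : R) : mu != 0 ->
  let s t := mu * (t - ts) in let rho := nu / mu in
  triangular_solution [set t | s t != 0]
    (fun t => A * s t - B ^+ 2 / 2 * s t ^+ 3 - rho ^+ 2 / 8 * (s t)^-1)
    (fun t => B * s t - rho / 2 * (s t)^-1)
    (fun t => (s t)^-1).
Proof.
move=> mu0 s rho t /= st.
have ds : is_derive t (1 : R) s mu.
  by apply: is_derive_eq; rewrite /GRing.scale/=; ring.
have dV : is_derive t (1 : R) (fun t => (s t)^-1) (- mu * (s t)^-1 ^+ 2).
  have := @is_deriveV R s t mu 1 st ds; rewrite /GRing.scale/= => dV.
  by apply: is_derive_eq; field.
have e8 : (8 : R) != 0 by rewrite pnatr_eq0.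
split=> //.
- by apply: is_derive_eq; rewrite /rho /GRing.scale/=; field; rewrite mu0 st.
- by apply: is_derive_eq; rewrite /rho /GRing.scale/=; field; rewrite mu0 st.
Qed.

(* [c t * (mu * (t - ts)) = 1] on [I], so the interval [I] avoids [ts]. *)
Lemma triangular_solution_blowup (I : set R) (a b c : R -> R) (t0 : R) :
  is_interval I -> triangular_solution I a b c -> I t0 -> c t0 != 0 -> mu != 0 ->
  let ts := t0 - (mu * c t0)^-1 in
  forall t, I t -> 0 < (mu * c t0) * (t - ts).
Proof.
move=> itvI S It0 ct0 mu0 ts.
have mc : mu * c t0 != 0 by rewrite mulf_neq0.
(* The left-hand side f satisfies f' = -mu c f, and [ts] is chosen so that f vanishes at [t0]. *)
have cs t : I t -> c t * (mu * (t - ts)) - 1 = 0.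
  move: t; apply: (linear_ode_eq0 _ _ _ (fun t => - mu * c t) t0) => // [t It|t It|].
  - have [_ _ dc] := S t It.
    by apply: is_derive_continuous; apply: is_derive_eq; reflexivity.
  - have [_ _ dc] := S t It.
    by apply: is_derive_eq; rewrite /GRing.scale/=; ring.
  - by rewrite /ts; field; rewrite mu0 ct0.
have tsNI : ~ I ts.
  by move=> /cs; rewrite subrr !mulr0 sub0r => /eqP; rewrite oppr_eq0 oner_eq0.
(* The affine function equals 1 at [t0]; were it nonpositive at t, its zero [ts] would lie between t
   and [t0], hence in [I]. *)
move=> t It; rewrite ltNge; apply/negP => le0; apply: tsNI.
have e0 : (mu * c t0) * (t0 - ts) = 1 by rewrite /ts; field; rewrite mu0 ct0.
have [mp|mn] : 0 < mu * c t0 \/ mu * c t0 < 0.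
  by move: mc; rewrite neq_lt => /orP[]; [right|left].
- apply: (itvI t t0) => //; apply/andP; split.
    by rewrite -subr_le0 -(pmulr_rle0 _ mp).
  by rewrite -subr_ge0 -(pmulr_rge0 _ mp) e0.
- apply: (itvI t0 t) => //; apply/andP; split.
    by rewrite -subr_le0 -(nmulr_rge0 _ mn) e0.
  by rewrite -subr_ge0 -(nmulr_rle0 _ mn).
Qed.

End triangular_system.

Lemma sl2_valD (R : realType) (x y : sl2 R) i j :
  vsval (x + y) i j = vsval x i j + vsval y i j.
Proof. by rewrite (linearD vsval) mxE. Qed.

Lemma sl2_valN (R : realType) (x : sl2 R) i j : vsval (- x) i j = - vsval x i j.
Proof. by rewrite (linearN vsval) mxE. Qed.

Lemma sl2_valZ (R : realType) (a : R) (x : sl2 R) i j :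
  vsval (a *: x) i j = a * vsval x i j.
Proof. by rewrite linearZ mxE. Qed.

Lemma sl2_val0 (R : realType) i j : vsval (0 : sl2 R) i j = 0.
Proof. by rewrite linear0 mxE. Qed.

(** These rules reduce vector identities to scalar ones between matrix entries, within reach of
    [ring] and [field]. *)
Definition sl2_valE := (sl2_valD, sl2_valN, sl2_valZ, sl2_val0).

(** * The Euler-Arnold equation in null coordinates *)

Section coordinates.
Variables (R : realType) (e1 e2 e3 : sl2 R) (eps k lambda : R).
Variable Phi : 'End(sl2 R).
Hypothesis eps_neq0 : eps != 0.
Hypotheses (B11 : sl2_form e1 e1 = 0) (B12 : sl2_form e1 e2 = 0)
  (B13 : sl2_form e1 e3 = eps) (B22 : sl2_form e2 e2 = eps)
  (B23 : sl2_form e2 e3 = 0) (B33 : sl2_form e3 e3 = 0).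
Hypotheses (K12 : sl2_bracket e1 e2 = k *: e1) (K23 : sl2_bracket e2 e3 = k *: e3)
  (K31 : sl2_bracket e3 e1 = k *: e2).
Hypotheses (Phi_inj : lker Phi = 0%VS) (lambda_neq0 : lambda != 0).
Hypotheses (Phi1 : Phi e1 = lambda *: e1) (Phi2 : Phi e2 = lambda *: e2 + e1)
  (Phi3 : Phi e3 = lambda *: e3 + e2).

(** [mu] and [nu] are k times the coefficients of N and N^2 in Phi^-1; the scalar part of Phi^-1
    contributes nothing, as [z,z] = 0. *)
Let mu := - k / lambda ^+ 2.
Let nu := k / lambda ^+ 3.
Let comb (a b c : R) := a *: e1 + b *: e2 + c *: e3.
Let formE := null_basis_form _ e1 e2 e3 eps B11 B12 B13 B22 B23 B33.

Let comb_eq (a b c a' b' c' : R) : a = a' -> b = b' -> c = c' ->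
  comb a b c = comb a' b' c'.
Proof. by move=> -> -> ->. Qed.

(** This is the finite series Phi^-1 = 1/lambda - N/lambda^2 + N^2/lambda^3, checked by applying
    [Phi]. *)
Lemma comb_inverse (a b c : R) : (Phi^-1)%VF (comb a b c) =
  comb (a / lambda - b / lambda ^+ 2 + c / lambda ^+ 3)
       (b / lambda - c / lambda ^+ 2) (c / lambda).
Proof.
rewrite -[RHS](lker0_lfunK (f := Phi)) ?Phi_inj//; congr ((Phi^-1)%VF _).
have PhiC a0 b0 c0 : Phi (comb a0 b0 c0) = a0 *: Phi e1 + b0 *: Phi e2 + c0 *: Phi e3.
  by rewrite !linearD !linearZ.
rewrite PhiC Phi1 Phi2 Phi3 /comb.
by apply: sl2_eqP; rewrite !sl2_valE; field.
Qed.

Lemma comb_bracket (a b c a' b' c' : R) :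
  sl2_bracket (comb a b c) (comb a' b' c') =
  comb (k * (a * b' - b * a')) (k * (c * a' - a * c')) (k * (b * c' - c * b')).
Proof.
rewrite /comb !(sl2_bracketDl, sl2_bracketZl, sl2_bracketDr, sl2_bracketZr).
rewrite !sl2_bracketxx (sl2_bracketC R e1 e2) (sl2_bracketC R e2 e3).
rewrite (sl2_bracketC R e3 e1) K12 K23 K31.
by apply: sl2_eqP; rewrite !sl2_valE; ring.
Qed.

Lemma comb_euler_arnold (a b c : R) :
  sl2_bracket (comb a b c) ((Phi^-1)%VF (comb a b c)) =
  comb (mu * (a * c - b ^+ 2) - nu * (b * c)) (mu * (b * c) + nu * c ^+ 2)
    (- mu * c ^+ 2).
Proof.
rewrite comb_inverse comb_bracket.
by apply: comb_eq; rewrite /mu /nu; field.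
Qed.

Lemma triangular_solution_curve (I : set R) (a b c : R -> R) :
  open I -> is_interval I -> I !=set0 -> triangular_solution R mu nu I a b c ->
  euler_arnold_solution Phi I (fun t => comb (a t) (b t) (c t)).
Proof.
move=> oI itvI I0 S; split; [exact: oI|exact: itvI|exact: I0|] => t /S[da db dc].
rewrite comb_euler_arnold; apply/is_derive_mxP => i j.
under eq_fun do rewrite !sl2_valE.
by rewrite !sl2_valE; apply: is_derive_eq; rewrite /GRing.scale/=; ring.
Qed.

Lemma solution_expansion z :
  z = comb (sl2_form z e3 / eps) (sl2_form z e2 / eps) (sl2_form z e1 / eps).
Proof. exact: null_basis_expansion. Qed.

(** Each coordinate is a fixed linear form in the entries of z, so its derivative is that form
    evaluated at the velocity, whose coordinates come from [comb_euler_arnold]. *)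
Lemma curve_triangular_solution (I : set R) (z : R -> sl2 R) :
  euler_arnold_solution Phi I z ->
  triangular_solution R mu nu I (fun t => sl2_form (z t) e3 / eps)
    (fun t => sl2_form (z t) e2 / eps) (fun t => sl2_form (z t) e1 / eps).
Proof.
move=> [_ _ _ dz] t It; have dw := dz t It.
pose a := sl2_form (z t) e3 / eps; pose b := sl2_form (z t) e2 / eps.
pose c := sl2_form (z t) e1 / eps.
have := comb_euler_arnold a b c.
rewrite -solution_expansion => Ew; rewrite {}Ew in dw.
set w := comb _ _ _ in dw.
have dform e : is_derive t (1 : R) (fun s => sl2_form (z s) e / eps)
    (sl2_form w e / eps).
  under eq_fun do rewrite sl2_formE.
  rewrite sl2_formE; have d i j := (is_derive_mxP _ _ _ _ _ _).1 dw i j.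
  have d00 := d 0 0; have d01 := d 0 1; have d10 := d 1 0.
  by apply: is_derive_eq; rewrite /GRing.scale/=; ring.
have [w1 w2 w3] := formE (mu * (a * c - b ^+ 2) - nu * (b * c))
  (mu * (b * c) + nu * c ^+ 2) (- mu * c ^+ 2).
by split; [have := dform e3|have := dform e2|have := dform e1];
  rewrite /w /comb ?w1 ?w2 ?w3 mulfK.
Qed.

Lemma solution_agrees (I : set R) (z : R -> sl2 R) (a b c : R -> R) (t0 : R) :
  euler_arnold_solution Phi I z -> triangular_solution R mu nu I a b c ->
  I t0 -> z t0 = comb (a t0) (b t0) (c t0) ->
  forall t, I t -> z t = comb (a t) (b t) (c t).
Proof.
move=> Sz S It0 z0 t It; have [_ itvI _ _] := Sz.
have := formE (a t0) (b t0) (c t0); rewrite /= -[X in sl2_form X]z0 => -[f1 f2 f3].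
have [] := triangular_solution_unique _ _ _ _ _ _ _ _ _ _ _ itvI
  (curve_triangular_solution _ _ Sz) S It0 _ _ _ t It.
- by rewrite f3 mulfK.
- by rewrite f2 mulfK.
- by rewrite f1 mulfK.
by move=> <- <- <-; exact: solution_expansion.
Qed.

(** The tool that computes maximal intervals: by uniqueness an explicit solution on [J] with the
    value of z at [t0] extends z, and maximality forbids a proper extension. *)
Lemma geodesic_domain (I J : set R) (z : R -> sl2 R) (a b c : R -> R) (t0 : R) :
  geodesic Phi I z -> open J -> is_interval J -> I `<=` J ->
  triangular_solution R mu nu J a b c ->
  I t0 -> z t0 = comb (a t0) (b t0) (c t0) -> J = I.
Proof.
move=> [Sz maxz] oJ itvJ IJ S It0 z0.
apply: (maxz J (fun t => comb (a t) (b t) (c t))) => //.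
  by apply: triangular_solution_curve => //; exists t0; exact: IJ.
move=> t It; apply/esym; apply: (solution_agrees I z a b c t0) => //.
by move=> u /IJ; exact: S.
Qed.


(** The plane c = 0 is the orthogonal of [e1]. A solution meeting it agrees with the affine solution
    through the same point, which stays in the plane. *)
Lemma solution_on_plane (I : set R) (z : R -> sl2 R) (t0 t : R) :
  euler_arnold_solution Phi I z -> I t0 -> sl2_form (z t0) e1 = 0 -> I t ->
  sl2_form (z t) e1 = 0.
Proof.
move=> Sz It0 z0 It; rewrite (solution_agrees I z _ _ _ t0 Sz
  (triangular_solution_c0 R mu nu I (sl2_form (z t0) e3 / eps)
     (sl2_form (z t0) e2 / eps) t0) It0 _ t It).
  by have [-> _ _] := formE
    (sl2_form (z t0) e3 / eps - mu * (sl2_form (z t0) e2 / eps) ^+ 2 * (t - t0))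
    (sl2_form (z t0) e2 / eps) 0; rewrite mul0r.
by rewrite [LHS]solution_expansion z0 mul0r subrr mulr0 subr0.
Qed.

Lemma geodesic_on_plane (I : set R) (z : R -> sl2 R) (t0 : R) :
  geodesic Phi I z -> I t0 -> sl2_form (z t0) e1 = 0 -> I = setT.
Proof.
move=> Gz It0 z0; apply/esym.
apply: (geodesic_domain I setT z _ _ _ t0 Gz _ _ _
  (triangular_solution_c0 R mu nu setT (sl2_form (z t0) e3 / eps)
     (sl2_form (z t0) e2 / eps) t0) It0).
- exact: openT.
- by move=> *.
- by move=> *.
- by rewrite [LHS]solution_expansion z0 mul0r subrr mulr0 subr0.
Qed.

(** The blow-up of c confines [I] to a half-line; the rational solution through z(t0) lives on that
    whole half-line, so maximality gives equality. *)
Lemma geodesic_off_plane (I : set R) (z : R -> sl2 R) (t0 : R) :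
  k != 0 -> geodesic Phi I z -> I t0 -> sl2_form (z t0) e1 != 0 ->
  exists d ts : R, d != 0 /\ I = [set t | 0 < d * (t - ts)].
Proof.
move=> k0 Gz It0 z0; have [Sz _] := Gz; have [_ itvI _ _] := Sz.
have mu0 : mu != 0 by rewrite /mu mulf_neq0 ?oppr_eq0// invr_neq0// expf_neq0.
have St := curve_triangular_solution I z Sz.
pose c0 := sl2_form (z t0) e1 / eps.
have c00 : c0 != 0 by rewrite mulf_neq0// invr_neq0.
pose d := mu * c0; have d0 : d != 0 by rewrite mulf_neq0.
pose ts := t0 - d^-1.
have IJ : I `<=` [set t | 0 < d * (t - ts)].
  by move=> t It; apply: (triangular_solution_blowup _ _ _ _ _ _ _ t0 itvI St).
exists d, ts; split => //; apply/esym.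
pose s t := mu * (t - ts); pose rho := nu / mu.
have s0 : s t0 = c0^-1.
  by rewrite /s /ts opprB addrC subrK /d invfM mulrA mulfV// mul1r.
pose b0 := sl2_form (z t0) e2 / eps; pose a0 := sl2_form (z t0) e3 / eps.
(* [B] and then [A] are obtained by solving the rational formulas for b and a at [t0], where s = 1 /
   c0. *)
pose B := (b0 + rho / 2 * c0) * c0.
pose A := (a0 + B ^+ 2 / 2 * c0^-1 ^+ 3 + rho ^+ 2 / 8 * c0) * c0.
have SJ := triangular_solution_rational R mu nu A B ts mu0.
apply: (geodesic_domain I _ z
  (fun t => A * s t - B ^+ 2 / 2 * s t ^+ 3 - rho ^+ 2 / 8 * (s t)^-1)
  (fun t => B * s t - rho / 2 * (s t)^-1) (fun t => (s t)^-1)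
  t0 Gz _ _ IJ _ It0); first last.
- rewrite [LHS]solution_expansion -/a0 -/b0 -/c0.
  have e8 : (8 : R) != 0 by rewrite pnatr_eq0.
  apply: comb_eq; rewrite /= s0.
  + by rewrite /A; field.
  + by rewrite /B; field.
  + by rewrite invrK.
- move=> t /= tJ; apply: SJ => /=.
  by apply: contraTneq tJ => /eqP; rewrite mulf_eq0 (negPf mu0)/= => /eqP ->;
    rewrite mulr0 ltxx.
- move=> x y /= xJ yJ w /andP[xw wy].
  have [dp|dn] : 0 < d \/ d < 0 by move: d0; rewrite neq_lt => /orP[]; [right|left].
    by rewrite (lt_le_trans xJ)// ler_pM2l// lerB.
  by rewrite (lt_le_trans yJ)// ler_nM2l// lerB.
- have -> : [set t | 0 < d * (t - ts)] = (fun t => d * (t - ts)) @^-1` [set x | 0 < x].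
    by [].
  apply: open_comp; last exact: open_gt.
  by move=> t _; apply: is_derive_continuous; apply: is_derive_eq; reflexivity.
Qed.

End coordinates.

(** * Half-lines and the conclusion *)

Lemma half_line_complete (R : realType) (d ts : R) : d != 0 ->
  let I := [set t | 0 < d * (t - ts)] in
  (Rplus_complete_interval I \/ Rminus_complete_interval I) /\
  ~ complete_interval I.
Proof.
move=> d0 I; split; last first.
  by move=> IT; have : I ts by [rewrite IT]; rewrite /I/= subrr mulr0 ltxx.
move: d0; rewrite neq_lt => /orP[dn|dp]; [right|left] => -[M bM].
(* This point lies below [ts], hence in [I], and also below the supposed lower bound [M]; the other
   case is symmetric. *)
- have := bM (Num.min M ts - 1).
  rewrite /I/= nmulr_rgt0// subr_lt0 leNgt; have := ge_min M M ts; have := ge_min ts M ts.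
  rewrite !lexx orbT/= => h1 h2 /(_ _)/negP; apply; lra.
- have := bM (Num.max M ts + 1).
  rewrite /I/= pmulr_rgt0// subr_gt0 leNgt; have := le_max M M ts; have := le_max ts M ts.
  rewrite !lexx orbT/= => h1 h2 /(_ _)/negP; apply; lra.
Qed.

Theorem theorem1p2 (R : realType) (q : {symmetric (sl2 R)})
  (q_nondegenerate : nondegenerate q)
  (Phi : 'End(sl2 R)) (Phi_q : associated_isomorphism q Phi)
  (lambda : R)
  (lambda_alg : algebraic_multiplicity Phi lambda = 3%N)
  (lambda_geo : geometric_multiplicity Phi lambda = 1%N) :
  exists P : {vspace (sl2 R)},
    [/\ \dim P = 2%N,
        flow_invariant Phi P,
        forall (I : set R) (z : R -> sl2 R),
          geodesic Phi I z -> lies_over P I z -> complete_interval I &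
        forall (I : set R) (z : R -> sl2 R),
          geodesic Phi I z -> ~ lies_over P I z ->
          (Rplus_complete_interval I \/ Rminus_complete_interval I) /\ ~ complete_interval I].
Proof.
have [adjPhi bijPhi _] := Phi_q.
pose N := (Phi - lambda *: \1)%VF.
have PhiE x : Phi x = lambda *: x + N x.
  by rewrite /N add_lfunE opp_lfunE scale_lfunE id_lfunE addrC subrK.
have NE x : N x = Phi x - lambda *: x by rewrite PhiE addrC addKr.
have adjN x y : sl2_form (N x) y = sl2_form x (N y).
  rewrite !NE -!scaleNr !(sl2_formDl, sl2_formZl) !(sl2_formDr, sl2_formZr).
  by rewrite adjPhi.
have N3 x : N (N (N x)) = 0.
  exact: (algebraic_multiplicity_dim3 _ _ _ _ _ (dim_sl2 R) lambda_alg).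
have [v N2v] := geometric_multiplicity1_dim3 _ _ _ _ (dim_sl2 R) lambda_geo.
have [e1 [e2 [e3 [eps [eps0 [N1 Ne2 Ne3] [B11 B12 B13] [B22 B23 B33]]]]]] :=
  nilpotent_null_basis _ _ _ adjN N3 N2v.
have [k k0 [K12 K23 K31]] :=
  null_basis_bracket _ _ _ _ _ eps0 B11 B12 B13 B22 B23 B33.
have Phi_inj : lker Phi = 0%VS by apply/eqP/lker0P; exact: bij_inj.
have Phi1 : Phi e1 = lambda *: e1 by rewrite PhiE N1 addr0.
have Phi2 : Phi e2 = lambda *: e2 + e1 by rewrite PhiE Ne2.
have Phi3 : Phi e3 = lambda *: e3 + e2 by rewrite PhiE Ne3.
have e10 : e1 != 0.
  by apply: contraNneq eps0 => e10; rewrite -B13 e10 sl2_form0l.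
(* [e1] is an eigenvector of the injective map [Phi]. *)
have lambda0 : lambda != 0.
  apply: contraNneq e10 => l0; rewrite -memv0 -Phi_inj memv_ker Phi1 l0 scale0r.
  by rewrite eqxx.
pose P := <<[:: e1; e2]>>%VS.
(* Membership in the span of [e1] and [e2] becomes the equation c = 0 used in the coordinate
   lemmas. *)
have memP z : (z \in P) = (sl2_form z e1 == 0).
  apply/idP/eqP => [|z0].
    rewrite /P span_cons span_seq1 => /memv_addP[_ /vlineP[a ->]] [_ /vlineP[b ->] ->].
    by rewrite sl2_formDl !sl2_formZl B11 (sl2_formC _ e2) B12 !mulr0 addr0.
  rewrite (null_basis_expansion _ _ _ _ _ eps0 B11 B12 B13 B22 B23 B33 z) z0.
  rewrite mul0r scale0r addr0 memvD// memvZ// memv_span// !inE eqxx ?orbT//.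
exists P; split.
- have := null_basis_free _ _ _ _ _ eps0 B11 B12 B13 B22 B23 B33.
  by rewrite -[X in free X]/([:: e1; e2] ++ [:: e3]) => /catl_free/eqP.
- move=> I z Sz t0 It0; rewrite memP => /eqP z0 t It; rewrite memP; apply/eqP.
  exact: (solution_on_plane _ e1 e2 e3 eps k lambda Phi eps0 B11 B12 B13 B22
    B23 B33 K12 K23 K31 Phi_inj lambda0 Phi1 Phi2 Phi3 I z t0).
- move=> I z Gz zP; have [[_ _ [t0 It0] _] _] := Gz.
  have /eqP z0 : sl2_form (z t0) e1 == 0 by rewrite -memP; exact: zP.
  exact: (geodesic_on_plane _ e1 e2 e3 eps k lambda Phi eps0 B11 B12 B13 B22
    B23 B33 K12 K23 K31 Phi_inj lambda0 Phi1 Phi2 Phi3 I z t0).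
(* A single time [t0] off the plane suffices, since it serves as the initial time. *)
- move=> I z Gz /existsNP[t0 /not_implyP[It0 zNP]].
  have z0 : sl2_form (z t0) e1 != 0 by rewrite -memP; exact/negP.
  have [d [ts [d0 ->]]] := geodesic_off_plane _ e1 e2 e3 eps k lambda Phi eps0 B11
    B12 B13 B22 B23 B33 K12 K23 K31 Phi_inj lambda0 Phi1 Phi2 Phi3 I z t0 k0 Gz It0 z0.
  exact: half_line_complete.
Qed.
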